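(* Consider the algorithm described in the context, suppose it does not terminate finitely, and suppose there is $\sigma_{\min}>0$ with $\sigma_{\min}(J_k)\ge\sigma_{\min}$ for all $k\in\mathbb{N}$. Then any limit point $x_*$ of the sequence $\{x_k\}$ is a first-order KKT point of the problem, i.e., $c(x_* )=0$ and there exist $y_*\in\mathbb{R}^m$ and $g_{r,*}\in\partial r(x_* )$ such that $\nabla f(x_* )+g_{r,*}-J(x_* )^Ty_*=0$.
   Context: Problem: $\min_{x\in\mathbb{R}^n} f(x)+r(x)$ subject to $c(x)=0$, where $f:\mathbb{R}^n\to\mathbb{R}$ and $c:\mathbb{R}^n\to\mathbb{R}^m$ ($m\le n$) are continuously differentiable and $r:\mathbb{R}^n\to\mathbb{R}_{\ge 0}$ is convex. Write $g(x)=\nabla f(x)$, $J(x)=\nabla c(x)^T$, and $f_k=f(x_k)$, $g_k=g(x_k)$, $c_k=c(x_k)$, $J_k=J(x_k)$, $r_k=r(x_k)$. All norms are Euclidean. Merit function: $\Phi_\tau(x)=\tau(f(x)+r(x))+\|c(x)\|_2$. Algorithm: inputs $x_0$, $\alpha_0>0$, $\tau_{-1}>0$; constants $\kappa_v>0$, $\sigma_c,\epsilon_\tau,\xi,\eta\in(0,1)$, $\sigma_u\in(0,1/2]$, $\bar\sigma_u:=\sigma_u+\tfrac12$. For $k=0,1,\dots$: 1. If $J_k^Tc_k\ne0$, compute $v_k$ with $v_k\in\mathrm{Range}(J_k^T)$, $\|v_k\|_2\le\kappa_v\alpha_k\|J_k^Tc_k\|_2$, $\|c_k+J_kv_k\|_2\le\|c_k+J_kv_k^c\|_2$,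 where $v_k^c=-\beta_k^cJ_k^Tc_k$ with $\beta_k^c$ minimizing $\tfrac12\|c_k-\beta J_kJ_k^Tc_k\|_2^2$ over $0\le\beta\le\kappa_v\alpha_k$. Otherwise set $v_k=0$, and if $c_k\ne0$ terminate. 2. Let $u_k$ be the unique minimizer of $g_k^Tu+\tfrac1{2\alpha_k}\|u\|_2^2+r(x_k+v_k+u)$ subject to $J_ku=0$; set $s_k=v_k+u_k$. If $s_k=0$, terminate. 3. Let $D_k:=g_k^Ts_k+\bar\sigma_u\|s_k\|_2^2/\alpha_k+r(x_k+s_k)-r_k$; $\tau_{k,\mathrm{trial}}=\infty$ if $D_k\le0$, else $\tau_{k,\mathrm{trial}}=(1-\sigma_c)(\|c_k\|_2-\|c_k+J_kv_k\|_2)/D_k$. Set $\tau_k=\tau_{k-1}$ if $\tau_{k-1}\le\tau_{k,\mathrm{trial}}$, else $\tau_k=\min\{(1-\epsilon_\tau)\tau_{k-1},\tau_{k,\mathrm{trial}}\}$. 4. With $\Delta q_k(s,\tau):=-\tau(g_k^Ts+\tfrac1{2\alpha_k}\|s\|_2^2+r(x_k+s)-r_k)+\|c_k\|_2-\|c_k+J_ks\|_2$: if $\Phi_{\tau_k}(x_k+s_k)\le\Phi_{\tau_k}(x_k)-\eta\Delta q_k(s_k,\tau_k)$ set $x_{k+1}=x_k+s_k$, $\alpha_{k+1}=\alpha_k$; else $x_{k+1}=x_k$, $\alpha_{k+1}=\xi\alpha_k$. Assumption: there is an open convex set $\mathcal X$ containing all iterates $x_k$ and trial points $x_k+s_k$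 such that $f$ is bounded below on $\mathcal X$, $\nabla f$ is bounded and Lipschitz continuous on $\mathcal X$, $c$ is bounded on $\mathcal X$, $J$ is bounded and Lipschitz continuous on $\mathcal X$, and all subgradients of $r$ at points of $\mathcal X$ are uniformly bounded in norm. *)

(* Defs.v *)
From mathcomp Require Import all_boot all_order all_algebra.
From mathcomp Require Import reals.
Set Implicit Arguments. Unset Strict Implicit. Unset Printing Implicit Defensive.
Import Order.TTheory GRing.Theory Num.Theory.
Local Open Scope ring_scope.

Definition vdot (R : realType) (n : nat) (u w : 'cV[R]_n) : R :=
  \sum_(i < n) u i ord0 * w i ord0.

Definition norm2 (R : realType) (n : nat) (w : 'cV[R]_n) : R :=
  Num.sqrt (vdot w w).

Definition has_gradient (R : realType) (n : nat)
    (f : 'cV[R]_n -> R) (g : 'cV[R]_n -> 'cV[R]_n) : Prop :=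
  forall x eps, 0 < eps -> exists delta, 0 < delta /\
    forall y, norm2 (y - x) < delta ->
      `|f y - f x - vdot (g x) (y - x)| <= eps * norm2 (y - x).

Definition has_jacobian (R : realType) (n m : nat)
    (c : 'cV[R]_n -> 'cV[R]_m) (J : 'cV[R]_n -> 'M[R]_(m, n)) : Prop :=
  forall x eps, 0 < eps -> exists delta, 0 < delta /\
    forall y, norm2 (y - x) < delta ->
      norm2 (c y - c x - J x *m (y - x)) <= eps * norm2 (y - x).

Definition vcontinuous (R : realType) (n p : nat)
    (h : 'cV[R]_n -> 'cV[R]_p) : Prop :=
  forall x eps, 0 < eps -> exists delta, 0 < delta /\
    forall y, norm2 (y - x) < delta -> norm2 (h y - h x) < eps.

Definition mcontinuous (R : realType) (n m : nat)
    (J : 'cV[R]_n -> 'M[R]_(m, n)) : Prop :=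
  forall x eps, 0 < eps -> exists delta, 0 < delta /\
    forall y, norm2 (y - x) < delta ->
      forall w, norm2 ((J y - J x) *m w) <= eps * norm2 w.

Definition C1_scalar (R : realType) (n : nat)
    (f : 'cV[R]_n -> R) (g : 'cV[R]_n -> 'cV[R]_n) : Prop :=
  has_gradient f g /\ vcontinuous g.

Definition C1_vector (R : realType) (n m : nat)
    (c : 'cV[R]_n -> 'cV[R]_m) (J : 'cV[R]_n -> 'M[R]_(m, n)) : Prop :=
  has_jacobian c J /\ mcontinuous J.

Definition convex_fun (R : realType) (n : nat) (r : 'cV[R]_n -> R) : Prop :=
  forall x y (t : R), 0 <= t -> t <= 1 ->
    r (t *: x + (1 - t) *: y) <= t * r x + (1 - t) * r y.

Definition subgrad (R : realType) (n : nat) (r : 'cV[R]_n -> R)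
    (x w : 'cV[R]_n) : Prop :=
  forall y, r x + vdot w (y - x) <= r y.

Definition open_set (R : realType) (n : nat) (X : 'cV[R]_n -> Prop) : Prop :=
  forall x, X x -> exists eps, 0 < eps /\
    forall y, norm2 (y - x) < eps -> X y.

Definition convex_set (R : realType) (n : nat) (X : 'cV[R]_n -> Prop) : Prop :=
  forall x y (t : R), X x -> X y -> 0 <= t -> t <= 1 -> X (t *: x + (1 - t) *: y).

(* "sigma_min(J) >= s" for J in R^{m x n}, m <= n, where
   sigma_min(J) = min_{||y||_2 = 1} ||J^T y||_2 (the m-th singular value). *)
Definition sigma_min_ge (R : realType) (n m : nat) (A : 'M[R]_(m, n)) (s : R) : Prop :=
  forall y : 'cV[R]_m, s * norm2 y <= norm2 (A^T *m y).

Definition merit (R : realType) (n m : nat) (f r : 'cV[R]_n -> R)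
    (c : 'cV[R]_n -> 'cV[R]_m) (t : R) (z : 'cV[R]_n) : R :=
  t * (f z + r z) + norm2 (c z).

(* the merit parameter update of Step 3; D <= 0 encodes tau_trial = +infinity *)
Definition tau_update (R : realType) (eps_tau tprev D num : R) : R :=
  if D <= 0 then tprev
  else if tprev <= num / D then tprev
  else Num.min ((1 - eps_tau) * tprev) (num / D).

Definition algo_run (R : realType) (n m : nat)
    (f : 'cV[R]_n -> R) (g : 'cV[R]_n -> 'cV[R]_n)
    (c : 'cV[R]_n -> 'cV[R]_m) (J : 'cV[R]_n -> 'M[R]_(m, n))
    (r : 'cV[R]_n -> R)
    (kappa_v sigma_c eps_tau xi eta sigma_u tau_m1 : R)
    (x : nat -> 'cV[R]_n) (alpha tau betac : nat -> R)
    (v u : nat -> 'cV[R]_n) : Prop :=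
  forall k : nat,
  let xk := x k in
  let ck := c xk in
  let Jk := J xk in
  let gk := g xk in
  let ak := alpha k in
  let sk := v k + u k in
  (Jk^T *m ck <> 0 ->
     (0 <= betac k /\ betac k <= kappa_v * ak /\
      (forall b : R, 0 <= b -> b <= kappa_v * ak ->
         (norm2 (ck - betac k *: (Jk *m Jk^T *m ck))) ^+ 2 / 2
           <= (norm2 (ck - b *: (Jk *m Jk^T *m ck))) ^+ 2 / 2)) /\
     (exists w : 'cV[R]_m, v k = Jk^T *m w) /\
     norm2 (v k) <= kappa_v * ak * norm2 (Jk^T *m ck) /\
     norm2 (ck + Jk *m v k) <= norm2 (ck + Jk *m (- (betac k *: (Jk^T *m ck))))) /\
  (Jk^T *m ck = 0 -> v k = 0) /\
  (Jk *m u k = 0 /\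
   forall w : 'cV[R]_n, Jk *m w = 0 ->
     vdot gk (u k) + (1 / (2 * ak)) * norm2 (u k) ^+ 2 + r (xk + v k + u k)
       <= vdot gk w + (1 / (2 * ak)) * norm2 w ^+ 2 + r (xk + v k + w)) /\
  (let Dk := vdot gk sk + (sigma_u + 1 / 2) * norm2 sk ^+ 2 / ak + r (xk + sk) - r xk in
   let tprev := if k is k'.+1 then tau k' else tau_m1 in
   tau k = tau_update eps_tau tprev Dk
             ((1 - sigma_c) * (norm2 ck - norm2 (ck + Jk *m v k)))) /\
  (let dq := - tau k * (vdot gk sk + (1 / (2 * ak)) * norm2 sk ^+ 2 + r (xk + sk) - r xk)
             + norm2 ck - norm2 (ck + Jk *m sk) in
   if merit f r c (tau k) (xk + sk) <= merit f r c (tau k) xk - eta * dq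
   then x k.+1 = xk + sk /\ alpha k.+1 = ak
   else x k.+1 = xk /\ alpha k.+1 = xi * ak).

(* The algorithm never terminates: no termination test of Steps 1 and 2 fires. *)
Definition never_terminates (R : realType) (n m : nat)
    (c : 'cV[R]_n -> 'cV[R]_m) (J : 'cV[R]_n -> 'M[R]_(m, n))
    (x : nat -> 'cV[R]_n) (v u : nat -> 'cV[R]_n) : Prop :=
  forall k, ((J (x k))^T *m c (x k) = 0 -> c (x k) = 0) /\ v k + u k <> 0.

Definition standing_assumption (R : realType) (n m : nat)
    (f : 'cV[R]_n -> R) (g : 'cV[R]_n -> 'cV[R]_n)
    (c : 'cV[R]_n -> 'cV[R]_m) (J : 'cV[R]_n -> 'M[R]_(m, n))
    (r : 'cV[R]_n -> R) (x : nat -> 'cV[R]_n) (v u : nat -> 'cV[R]_n) : Prop :=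
  exists X : 'cV[R]_n -> Prop,
    open_set X /\ convex_set X /\
    (forall k, X (x k)) /\ (forall k, X (x k + (v k + u k))) /\
    (exists lb, forall z, X z -> lb <= f z) /\
    (exists B, forall z, X z -> norm2 (g z) <= B) /\
    (exists L, forall z w, X z -> X w -> norm2 (g z - g w) <= L * norm2 (z - w)) /\
    (exists B, forall z, X z -> norm2 (c z) <= B) /\
    (exists B, forall z (w : 'cV[R]_n), X z -> norm2 (J z *m w) <= B * norm2 w) /\
    (exists L, forall z z' (w : 'cV[R]_n), X z -> X z' ->
        norm2 ((J z - J z') *m w) <= L * norm2 (z - z') * norm2 w) /\
    (exists B, forall z w, X z -> subgrad r z w -> norm2 w <= B).

Definition limit_point (R : realType) (n : nat) (x : nat -> 'cV[R]_n)
    (xs : 'cV[R]_n) : Prop :=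
  forall eps, 0 < eps -> forall N : nat, exists k, (N <= k)%N /\ norm2 (x k - xs) < eps.

Definition kkt_point (R : realType) (n m : nat)
    (g : 'cV[R]_n -> 'cV[R]_n) (c : 'cV[R]_n -> 'cV[R]_m)
    (J : 'cV[R]_n -> 'M[R]_(m, n)) (r : 'cV[R]_n -> R) (xs : 'cV[R]_n) : Prop :=
  c xs = 0 /\
  exists (y : 'cV[R]_m) (gr : 'cV[R]_n),
    subgrad r xs gr /\ g xs + gr - (J xs)^T *m y = 0.

(* Main.v *)
(* Optimality of u_k gives multipliers y_k and p_k in dr(x_k + s_k) with
   g_k + u_k / alpha_k + p_k = J_k^T y_k. Since u_k is orthogonal to v_k, testing
   with u_k bounds D_k by a multiple of |v_k|, while the Cauchy condition makes
   |c_k| - |c_k + J_k v_k| at least a multiple of |v_k| and of alpha_k |c_k|;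
   hence tau_k stays bounded away from 0. Once alpha_k is small the quadratic
   term of the model dominates the curvature and the step is accepted, so alpha_k
   is bounded away from 0 too. The potential
     tau_k (f - lb + r)(x_k) + |c_k| + alpha_k,
   with lb a lower bound of f, is nonnegative and nonincreasing; it drops
   by a fixed amount at each rejection and by eta * Delta q_k at each acceptance.
   So rejections stop and Delta q_k,
   hence s_k, u_k / alpha_k and c_k, tend to 0. Passing to the limit in the
   subgradient inequality, with the y_k bounded by sigma_min, shows that 0 minimizes
   w |-> g(xs).w + r(xs + w) over the kernel of J at the limit point xs, and the
   multipliers of this convex problem are those sought. *)
Require Import Defs.
From mathcomp Require Import all_boot all_order all_algebra.
From mathcomp Require Import boolp classical_sets reals ring lra.
Set Implicit Arguments. Unset Strict Implicit. Unset Printing Implicit Defensive.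
Import Order.TTheory GRing.Theory Num.Theory.
Local Open Scope ring_scope.

(** * Euclidean inner product and norm *)

Lemma vdotC (R : realType) n (u w : 'cV[R]_n) : vdot u w = vdot w u.
Proof. by apply: eq_bigr => i _; rewrite mulrC. Qed.

Lemma vdotDl (R : realType) n (u v w : 'cV[R]_n) :
  vdot (u + v) w = vdot u w + vdot v w.
Proof. by rewrite -big_split; apply: eq_bigr => i _; rewrite mxE mulrDl. Qed.

Lemma vdotZl (R : realType) n (a : R) (u w : 'cV[R]_n) :
  vdot (a *: u) w = a * vdot u w.
Proof. by rewrite mulr_sumr; apply: eq_bigr => i _; rewrite mxE mulrA. Qed.

Lemma vdotNl (R : realType) n (u w : 'cV[R]_n) : vdot (- u) w = - vdot u w.
Proof. by rewrite -scaleN1r vdotZl mulN1r. Qed.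

Lemma vdotDr (R : realType) n (u v w : 'cV[R]_n) :
  vdot u (v + w) = vdot u v + vdot u w.
Proof. by rewrite vdotC vdotDl !(vdotC u). Qed.

Lemma vdotZr (R : realType) n (a : R) (u w : 'cV[R]_n) :
  vdot u (a *: w) = a * vdot u w.
Proof. by rewrite vdotC vdotZl vdotC. Qed.

Lemma vdotNr (R : realType) n (u w : 'cV[R]_n) : vdot u (- w) = - vdot u w.
Proof. by rewrite vdotC vdotNl vdotC. Qed.

Lemma vdot0l (R : realType) n (w : 'cV[R]_n) : vdot 0 w = 0.
Proof. by rewrite -(scale0r 0) vdotZl mul0r. Qed.

Lemma vdot0r (R : realType) n (w : 'cV[R]_n) : vdot w 0 = 0.
Proof. by rewrite vdotC vdot0l. Qed.

Definition vdotE := (vdotDl, vdotDr, vdotZl, vdotZr, vdotNl, vdotNr, vdot0l, vdot0r).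

Lemma vdotMl (R : realType) m n (A : 'M[R]_(m, n)) u w :
  vdot (A *m u) w = vdot u (A^T *m w).
Proof.
have E p (a b : 'cV[R]_p) : vdot a b = (a^T *m b) ord0 ord0.
  by rewrite mxE; apply: eq_bigr => i _; rewrite mxE.
by rewrite !E trmx_mul mulmxA.
Qed.

Lemma vdot_ge0 (R : realType) n (w : 'cV[R]_n) : 0 <= vdot w w.
Proof. by apply: sumr_ge0 => i _; rewrite -expr2 sqr_ge0. Qed.

Lemma norm2_ge0 (R : realType) n (w : 'cV[R]_n) : 0 <= norm2 w.
Proof. exact: sqrtr_ge0. Qed.

Lemma norm2_sqr (R : realType) n (w : 'cV[R]_n) : norm2 w ^+ 2 = vdot w w.
Proof. by rewrite sqr_sqrtr ?vdot_ge0. Qed.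

Lemma norm2_eq0 (R : realType) n (w : 'cV[R]_n) : norm2 w = 0 -> w = 0.
Proof.
move=> w0; have /eqP : vdot w w = 0 by rewrite -norm2_sqr w0 expr0n.
rewrite psumr_eq0; last by move=> i _; rewrite -expr2 sqr_ge0.
move=> /allP wi; apply/colP => i; rewrite mxE; apply/eqP.
by have := wi i (mem_index_enum i); rewrite /= mulf_eq0 orbb.
Qed.

Lemma norm2_0 (R : realType) n : norm2 (0 : 'cV[R]_n) = 0.
Proof. by rewrite /norm2 vdot0l sqrtr0. Qed.

Lemma norm2Z (R : realType) n (a : R) (w : 'cV[R]_n) :
  norm2 (a *: w) = `|a| * norm2 w.
Proof.
by rewrite /norm2 !vdotE mulrA -expr2 sqrtrM ?sqr_ge0 // sqrtr_sqr.
Qed.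

Lemma norm2N (R : realType) n (w : 'cV[R]_n) : norm2 (- w) = norm2 w.
Proof. by rewrite -scaleN1r norm2Z normrN1 mul1r. Qed.

Lemma norm2_subC (R : realType) n (u w : 'cV[R]_n) : norm2 (u - w) = norm2 (w - u).
Proof. by rewrite -norm2N opprB. Qed.

Lemma cauchy_schwarz (R : realType) n (u w : 'cV[R]_n) :
  vdot u w <= norm2 u * norm2 w.
Proof.
have [/norm2_eq0 ->|u0] := eqVneq (norm2 u) 0; first by rewrite vdot0l norm2_0 mul0r.
have [/norm2_eq0 ->|w0] := eqVneq (norm2 w) 0; first by rewrite vdot0r norm2_0 mulr0.
have up : 0 < norm2 u by rewrite lt_def u0 norm2_ge0.
have wp : 0 < norm2 w by rewrite lt_def w0 norm2_ge0.
have := vdot_ge0 (norm2 w *: u - norm2 u *: w).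
rewrite !vdotE -!norm2_sqr (vdotC w u) => H.
rewrite -subr_ge0 -(pmulr_rge0 _ (mulr_gt0 up wp)).
by nra.
Qed.

Lemma cauchy_schwarzN (R : realType) n (u w : 'cV[R]_n) :
  - (norm2 u * norm2 w) <= vdot u w.
Proof. by have := cauchy_schwarz (- u) w; rewrite vdotNl norm2N lerNl. Qed.

Lemma norm2D (R : realType) n (u w : 'cV[R]_n) :
  norm2 (u + w) <= norm2 u + norm2 w.
Proof.
rewrite -(ler_sqr (norm2_ge0 _)) ?nnegrE ?addr_ge0 ?norm2_ge0 //.
rewrite norm2_sqr !vdotE -!norm2_sqr (vdotC w u).
by have := cauchy_schwarz u w; nra.
Qed.

Lemma norm2B (R : realType) n (u w : 'cV[R]_n) :
  norm2 (u - w) <= norm2 u + norm2 w.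
Proof. by rewrite -(norm2N w) norm2D. Qed.

Lemma norm2_sub_le (R : realType) n (u w : 'cV[R]_n) :
  norm2 u <= norm2 w + norm2 (u - w).
Proof. by apply: le_trans (norm2D _ _); rewrite addrC subrK. Qed.

(** Testing with [q = A^T y] gives [|q|^2 = <y, A q> <= B |y| |q|], and a factor [|q|] cancels. *)
Lemma norm2_trmx (R : realType) m n (A : 'M[R]_(m, n)) (B : R) :
  0 <= B -> (forall w, norm2 (A *m w) <= B * norm2 w) ->
  forall y, norm2 (A^T *m y) <= B * norm2 y.
Proof.
move=> B0 AB y; set q := A^T *m y.
have [->|q0] := eqVneq (norm2 q) 0; first by rewrite mulr_ge0 ?norm2_ge0.
have qp : 0 < norm2 q by rewrite lt_def q0 norm2_ge0.
rewrite -(ler_pM2r qp) -expr2 norm2_sqr vdotMl trmxK.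
apply: le_trans (cauchy_schwarz _ _) _.
by have := AB q; have := norm2_ge0 y; nra.
Qed.

(** * Separation and multipliers for linear equality constraints *)

(* A line through the origin below the convex set of pairs (l w, h w): every slope
   forced from one side is compatible with every slope forced from the other. *)
Lemma separating_slope (R : realType) n (S : 'cV[R]_n -> Prop)
    (h l : 'cV[R]_n -> R) :
  convex_set S -> (forall w, S w -> S (- w)) -> convex_fun h ->
  (forall w, l (- w) = - l w) ->
  (forall x y t, l (t *: x + (1 - t) *: y) = t * l x + (1 - t) * l y) ->
  (forall w, S w -> l w = 0 -> 0 <= h w) ->
  exists a, forall w, S w -> 0 <= h w + a * l w.
Proof.
move=> cS SN ch lN lA h0.
pose L : set R := fun a => exists w, S w /\ 0 < l w /\ a = - h w / l w.
have ub w : S w -> l w < 0 -> forall a, L a -> a <= h w / - l w.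
  move=> Sw lw _ [z [Sz [lz ->]]].
  have dp : 0 < l z - l w by lra.
  (* The weight [t] places the convex combination of [z] and [w] on [l = 0], where [h0] applies. *)
  pose t := - l w / (l z - l w).
  have t0 : 0 <= t by apply: divr_ge0; lra.
  have t1 : t <= 1 by rewrite ler_pdivrMr //; lra.
  have E : t * l z + (1 - t) * l w = 0 by rewrite /t; field; lra.
  have := h0 _ (cS _ _ _ Sz Sw t0 t1); rewrite lA => /(_ E).
  move=> /le_trans /(_ (ch z w t t0 t1)) H.
  have : 0 <= (l z - l w) * (t * h z + (1 - t) * h w) by apply: mulr_ge0 => //; lra.
  have -> : (l z - l w) * (t * h z + (1 - t) * h w) = - l w * h z + l z * h w.
    by rewrite /t; field; lra.
  move=> H2; rewrite ler_pdivrMr // mulrAC ler_pdivlMr; lra.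
have [[w [Sw lw]]|no] := pselect (exists w, S w /\ 0 < l w); last first.
  exists 0 => w Sw; rewrite mul0r addr0; apply: h0 => //.
  have [H|H|//] := ltgtP (l w) 0.
    by case: no; exists (- w); split; [exact: SN|rewrite lN; lra].
  by case: no; exists w.
have L0 : (L !=set0)%classic by exists (- h w / l w), w.
have uL : has_ubound L.
  exists (h (- w) / - l (- w)) => a La; apply: ub => //; first exact: SN.
  by rewrite lN; lra.
exists (sup L) => z Sz.
have [H|H|H] := ltgtP (l z) 0.
- have : sup L <= h z / - l z by apply: ge_sup => // a; exact: ub.
  by rewrite ler_pdivlMr; lra.
- have : - h z / l z <= sup L by apply: ub_le_sup => //; exists z.
  by rewrite ler_pdivrMr //; lra.
- by rewrite H mulr0 addr0; exact: h0.
Qed.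

(* The constraints [(A w)_i = 0] are relaxed one at a time. *)
Lemma multiplier (R : realType) m n (A : 'M[R]_(m, n)) (h : 'cV[R]_n -> R) :
  convex_fun h -> (forall w, A *m w = 0 -> 0 <= h w) ->
  exists y, forall w, 0 <= h w + vdot y (A *m w).
Proof.
move=> ch h0.
suff H k : (k <= m)%N -> exists y : 'cV[R]_m, forall w,
    (forall i : 'I_m, (k <= i)%N -> (A *m w) i ord0 = 0) -> 0 <= h w + vdot y (A *m w).
  have [y Hy] := H m (leqnn m); exists y => w; apply: Hy => i.
  by rewrite leqNgt ltn_ord.
elim: k => [_|k IH km].
  exists 0 => w Aw; rewrite vdot0l addr0; apply: h0; apply/colP => i.
  by rewrite Aw // mxE.
have [y Hy] := IH (ltnW km); pose j := Ordinal km.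
(* [S] keeps the constraints beyond index [k]; the one at [j] is traded for a slope [a]. *)
pose S (w : 'cV[R]_n) := forall i : 'I_m, (k < i)%N -> (A *m w) i ord0 = 0.
have lD p q t i : (A *m (t *: p + (1 - t) *: q)) i ord0
    = t * (A *m p) i ord0 + (1 - t) * (A *m q) i ord0.
  by rewrite mulmxDr -!scalemxAr; move: (A *m p) (A *m q) => P Q; rewrite !mxE.
have lN p i : (A *m (- p)) i ord0 = - (A *m p) i ord0.
  by rewrite mulmxN; move: (A *m p) => P; rewrite mxE.
have [||||||a Ha] := @separating_slope R n S (fun w => h w + vdot y (A *m w))
    (fun w => (A *m w) j ord0).
- move=> p q t Sp Sq _ _ i ki.
  by rewrite lD Sp // Sq // !mulr0 addr0.
- by move=> p Sp i ki; rewrite lN Sp ?oppr0.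
- move=> p q t t0 t1; rewrite mulmxDr -!scalemxAr !vdotE.
  by have := ch p q t t0 t1; lra.
- by move=> w; rewrite lN.
- by move=> p q t; rewrite lD.
- move=> w Sw wj; apply: Hy => i; rewrite leq_eqVlt => /orP[/eqP ki|]; last exact: Sw.
  by rewrite -wj; congr (_ _ _); apply: val_inj.
exists (y + a *: delta_mx j ord0) => w Sw.
have := Ha w Sw; rewrite !vdotE addrA.
suff -> : vdot (delta_mx j ord0) (A *m w) = (A *m w) j ord0 by [].
rewrite /vdot (bigD1 j) //= big1 => [|i ij]; rewrite mxE ?eqxx ?mul1r ?addr0 //.
by rewrite (negbTE ij) mul0r.
Qed.

(** * First-order conditions for convex minimization over a kernel *)

Lemma ler_small (R : realType) (a b : R) :
  (forall t, 0 < t -> t <= 1 -> 0 <= a + t * b) -> 0 <= a.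
Proof.
move=> H; rewrite leNgt; apply/negP => a0.
have [b0|b0] := lerP b 0; first by have := H 1; lra.
pose t := - a / (2 * (b - a)).
have dp : 0 < 2 * (b - a) by lra.
have t0 : 0 < t by apply: divr_gt0; lra.
have t1 : t <= 1 by rewrite ler_pdivrMr //; lra.
have := H t t0 t1.
have E : t * (2 * (b - a)) = - a by rewrite /t; field; lra.
nra.
Qed.

(** A multiplier [y0] extends the inequality from the kernel to the whole space, where it says that
    [- q - A^T y0] is a subgradient; the [y] returned is [- y0]. *)
Lemma subgrad_multiplier (R : realType) m n (A : 'M[R]_(m, n)) (r : 'cV[R]_n -> R) z q :
  convex_fun r ->
  (forall w, A *m w = 0 -> r z <= r (z + w) + vdot q w) ->
  exists y p, subgrad r z p /\ q + p - A^T *m y = 0.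
Proof.
move=> cr H.
have [||y Hy] := @multiplier R m n A (fun w => r (z + w) - r z + vdot q w).
- move=> p w t t0 t1 /=; rewrite !vdotE.
  have := cr (z + p) (z + w) t t0 t1.
  suff -> : t *: (z + p) + (1 - t) *: (z + w) = z + (t *: p + (1 - t) *: w) by lra.
  by apply/colP => i; rewrite !mxE; ring.
- by move=> w /H; lra.
exists (- y), (- q + A^T *m (- y)); split; last by rewrite addrA addrN add0r addrN.
move=> w; have := Hy (w - z); rewrite (addrC z) subrK.
rewrite mulmxN vdotDl !vdotNl vdotMl trmxK; lra.
Qed.

Lemma subgrad_exists (R : realType) n (r : 'cV[R]_n -> R) z :
  convex_fun r -> exists p, subgrad r z p.
Proof.
move=> cr; have [|y [p [rp _]]] := @subgrad_multiplier R n n 1%:M r z 0 cr.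
  by move=> w; rewrite mul1mx => ->; rewrite addr0 vdot0l addr0.
by exists p.
Qed.

(** The minimizer is compared with [u + t w]. By convexity of [r], division by [t] leaves the
    linearized inequality up to [t |w|^2 / (2 a)], which [ler_small] removes. *)
Lemma prox_optimality (R : realType) m n (A : 'M[R]_(m, n)) (r : 'cV[R]_n -> R) g z u (a : R) :
  convex_fun r -> 0 < a -> A *m u = 0 ->
  (forall w, A *m w = 0 ->
     vdot g u + 1 / (2 * a) * norm2 u ^+ 2 + r (z + u)
     <= vdot g w + 1 / (2 * a) * norm2 w ^+ 2 + r (z + w)) ->
  exists y p, subgrad r (z + u) p /\ g + a^-1 *: u + p - A^T *m y = 0.
Proof.
move=> cr a0 Au H; apply: subgrad_multiplier => // w Aw.
rewrite -subr_ge0; apply: (@ler_small _ _ (1 / (2 * a) * vdot w w)) => t t0 t1.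
have Auw : A *m (u + t *: w) = 0 by rewrite mulmxDr -scalemxAr Au Aw scaler0 addr0.
have := H _ Auw; rewrite !norm2_sqr !vdotE (vdotC w u).
have := cr (z + u + w) (z + u) t (ltW t0) t1.
have -> : t *: (z + u + w) + (1 - t) *: (z + u) = z + (u + t *: w).
  by apply/colP => i; rewrite !mxE; ring.
have -> : 1 / (2 * a) = a^-1 / 2 by field; lra.
move: a^-1 => b H1 H2.
rewrite -(pmulr_rge0 _ t0); nra.
Qed.

(** * Taylor estimates along segments *)

(** Continuous induction: the local estimate at the supremum of the points satisfying the bound with
    slope [K + e] shows that the supremum satisfies it too and cannot be below 1. *)
Lemma mean_value_le (R : realType) (h : R -> R) (K : R) :
  (forall t eps, 0 <= t -> t <= 1 -> 0 < eps -> exists d, 0 < d /\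
     forall t', 0 <= t' -> t' <= 1 -> `|t' - t| < d ->
       `|h t' - h t| <= (K + eps) * `|t' - t|) ->
  h 1 - h 0 <= K.
Proof.
move=> H; apply/ler_addgt0Pr => e e0.
pose S : set R := fun t => 0 <= t /\ t <= 1 /\ h t - h 0 <= (K + e) * t.
have S0 : S 0 by split=> //; split=> //; rewrite subrr mulr0.
have uS : has_ubound S by exists 1 => t [_ []].
have nS : (S !=set0)%classic by exists 0.
have s0 : 0 <= sup S by exact: ub_le_sup.
have s1 : sup S <= 1 by apply: ge_sup => // t [_ []].
have [d [d0 Hd]] := H _ _ s0 s1 e0.
have hs : S (sup S).
  have [t [t0 [t1 ht]] td] := sup_adherent d0 (conj nS uS).
  have ts : t <= sup S by apply: ub_le_sup => //; split.
  have tE : `|t - sup S| = sup S - t by rewrite ler0_norm; lra.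
  have := Hd t t0 t1; rewrite tE ler_norml => /(_ _) /andP[|H1 _]; first by lra.
  by split=> //; split=> //; nra.
have [s1'|s1'] := ltP (sup S) 1; last first.
  have E : sup S = 1 by lra.
  by move: hs; rewrite E => -[_ [_]]; rewrite mulr1.
pose t := Num.min 1 (sup S + d / 2).
have ts : sup S < t by rewrite lt_min s1'; lra.
have t1 : t <= 1 by rewrite ge_min lexx.
have td : t <= sup S + d / 2 by rewrite ge_min lexx orbT.
have tE : `|t - sup S| = t - sup S by rewrite ger0_norm; lra.
have t0 : 0 <= t by lra.
have := Hd t t0 t1; rewrite tE ler_norml => /(_ _) /andP[|_ H1]; first by lra.
have : t <= sup S.
  apply: ub_le_sup => //; split=> //; split=> //.
  by case: hs => _ [_]; nra.
by lra.
Qed.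

Lemma segment_in (R : realType) n (X : 'cV[R]_n -> Prop) z s (t : R) :
  convex_set X -> X z -> X (z + s) -> 0 <= t -> t <= 1 -> X (z + t *: s).
Proof.
move=> cX Xz Xs t0 t1; have := cX _ _ t Xs Xz t0 t1.
by congr X; apply/colP => i; rewrite !mxE; ring.
Qed.

(** The remainder is paired with itself, as [d], to get a scalar function on the segment. Its slope
    [<d, (J(z + t s) - J z) s>] is at most [|d| L |s|^2], and [|d|] cancels. Bounding the slope
    uniformly gives the constant [L] instead of [L / 2]. *)
Lemma descent_vector (R : realType) n m (c : 'cV[R]_n -> 'cV[R]_m) J X (L : R) z s :
  has_jacobian c J -> convex_set X -> X z -> X (z + s) -> 0 <= L ->
  (forall z z' (w : 'cV[R]_n), X z -> X z' ->
     norm2 ((J z - J z') *m w) <= L * norm2 (z - z') * norm2 w) ->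
  norm2 (c (z + s) - c z - J z *m s) <= L * norm2 s ^+ 2.
Proof.
move=> Jc cX Xz Xs L0 JL.
pose d := c (z + s) - c z - J z *m s.
have [d0|d0] := eqVneq (norm2 d) 0.
  by rewrite -/d d0 mulr_ge0 // exprn_ge0 ?norm2_ge0.
have dp : 0 < norm2 d by rewrite lt_def d0 norm2_ge0.
pose h t := vdot d (c (z + t *: s) - t *: (J z *m s)).
have : h 1 - h 0 <= norm2 d * (L * norm2 s ^+ 2).
  apply: mean_value_le => t e t0 t1 e0.
  have Xt := segment_in cX Xz Xs t0 t1.
  have sp : 0 < norm2 s + 1 by have := norm2_ge0 s; lra.
  (* The tolerance is scaled because the Jacobian error gets multiplied by [|d|] and [|s|]; the
     [+ 1] covers [s = 0]. *)
  have ep : 0 < e / (norm2 d * (norm2 s + 1)) by rewrite divr_gt0 // mulr_gt0.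
  have [r [r0 Hr]] := Jc (z + t *: s) _ ep.
  exists (r / (norm2 s + 1)); split; first by rewrite divr_gt0.
  move=> t' t'0 t'1; rewrite ltr_pdivlMr // => tr.
  have E : z + t' *: s - (z + t *: s) = (t' - t) *: s.
    by apply/colP => i; rewrite !mxE; ring.
  have ts : norm2 (z + t' *: s - (z + t *: s)) < r.
    by rewrite E norm2Z; have := normr_ge0 (t' - t); have := norm2_ge0 s; nra.
  have := Hr _ ts; rewrite E norm2Z -scalemxAr.
  set q := c _ - _ - _ => Hq.
  have -> : h t' - h t = vdot d (q + (t' - t) *: ((J (z + t *: s) - J z) *m s)).
    rewrite /h /q mulmxBl !vdotE; ring.
  have Hj := JL _ _ s Xt Xz.
  have CS w : `|vdot d w| <= norm2 d * norm2 w.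
    by rewrite ler_norml cauchy_schwarzN cauchy_schwarz.
  apply: le_trans (CS _) _.
  have -> : (norm2 d * (L * norm2 s ^+ 2) + e) * `|t' - t| =
     norm2 d * (((L * norm2 s ^+ 2) + e / norm2 d) * `|t' - t|) by field.
  rewrite ler_pM2l //; apply: le_trans (norm2D _ _) _; rewrite norm2Z.
  have T0 := normr_ge0 (t' - t).
  have E2 : e / (norm2 d * (norm2 s + 1)) * (`|t' - t| * norm2 s) <= e / norm2 d * `|t' - t|.
    have -> : e / (norm2 d * (norm2 s + 1)) = (e / norm2 d) / (norm2 s + 1).
      by field; rewrite d0; lra.
    have ed : 0 < e / norm2 d by rewrite divr_gt0.
    have : norm2 s / (norm2 s + 1) <= 1 by rewrite ler_pdivrMr //; lra.
    have -> : e / norm2 d / (norm2 s + 1) * (`|t' - t| * norm2 s) =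
        (e / norm2 d * `|t' - t|) * (norm2 s / (norm2 s + 1)).
      by field; rewrite d0; lra.
    by move=> Hs; rewrite ler_piMr // mulr_ge0 // ltW.
  have E3 : norm2 ((J (z + t *: s) - J z) *m s) <= L * norm2 s ^+ 2.
    apply: le_trans Hj _; rewrite (addrC z) addrK norm2Z (ger0_norm t0).
    have : t * (L * norm2 s ^+ 2) <= 1 * (L * norm2 s ^+ 2).
      by rewrite ler_wpM2r // mulr_ge0 // exprn_ge0 ?norm2_ge0.
    by lra.
  have := ler_wpM2l T0 E3; lra.
have -> : h 1 - h 0 = norm2 d * norm2 d.
  rewrite -expr2 norm2_sqr /h !scale1r !scale0r addr0 subr0 -vdotNr -vdotDr.
  by rewrite [X in vdot d X]addrAC.
by rewrite ler_pM2l.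
Qed.


(** The vector case with [m = 1], the Jacobian being the transposed gradient. *)
Lemma descent_scalar (R : realType) n (f : 'cV[R]_n -> R) g X (L : R) z s :
  has_gradient f g -> convex_set X -> X z -> X (z + s) -> 0 <= L ->
  (forall z w, X z -> X w -> norm2 (g z - g w) <= L * norm2 (z - w)) ->
  f (z + s) - f z - vdot (g z) s <= L * norm2 s ^+ 2.
Proof.
move=> fg cX Xz Xs L0 gL.
have mulE (p w : 'cV[R]_n) : p^T *m w = (vdot p w)%:M.
  by apply/matrixP => i j; rewrite !ord1 !mxE eqxx mulr1n; apply: eq_bigr => k _; rewrite mxE.
have norm1 (a : R) : norm2 (a%:M : 'cV[R]_1) = `|a|.
  by rewrite /norm2 /vdot big_ord1 !mxE eqxx mulr1n -expr2 sqrtr_sqr.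
have H1 (a b d : R) : norm2 (a%:M - b%:M - d%:M : 'cV[R]_1) = `|a - b - d|.
  by rewrite -!raddfB norm1.
have Jf : has_jacobian (fun w => (f w)%:M : 'cV[R]_1) (fun w => (g w)^T).
  move=> w e e0; have [d [d0 Hd]] := fg w e e0; exists d; split=> // y yd.
  by rewrite mulE H1; exact: Hd.
have := descent_vector Jf cX Xz Xs L0.
rewrite mulE H1 => /(_ _)/(le_trans (ler_norm _)); apply.
move=> p q w Xp Xq; rewrite -raddfB mulE norm1.
have := gL _ _ Xp Xq; have := norm2_ge0 w.
have := cauchy_schwarz (g p - g q) w; have := cauchy_schwarzN (g p - g q) w.
by move=> A1 A2 A3 A4; rewrite ler_norml; apply/andP; split; nra.
Qed.

(** * Bounds on the normal and tangential steps *)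

(** The optimal [beta] is compared with [b = min(K, 1 / B^2)]. As [b B^2 <= 1], the quadratic term
    is at most half of the linear gain [2 b |A^T c|^2]. *)
Lemma cauchy_decrease (R : realType) m n (A : 'M[R]_(m, n)) c v (B K beta : R) :
  0 < B -> 0 < K -> (forall w, norm2 (A *m w) <= B * norm2 w) ->
  (forall b : R, 0 <= b -> b <= K ->
     norm2 (c - beta *: (A *m A^T *m c)) ^+ 2 / 2
     <= norm2 (c - b *: (A *m A^T *m c)) ^+ 2 / 2) ->
  norm2 (c + A *m v) <= norm2 (c + A *m (- (beta *: (A^T *m c)))) ->
  norm2 (c + A *m v) ^+ 2 <=
    norm2 c ^+ 2 - Num.min K (B ^- 2) * norm2 (A^T *m c) ^+ 2.
Proof.
move=> B0 K0 AB Hb Hv; set b := Num.min _ _.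
have Bm0 : 0 < B ^- 2 by rewrite invr_gt0 exprn_gt0.
have b0 : 0 <= b by rewrite le_min !ltW.
have bK : b <= K by rewrite ge_min lexx.
have bB : b * B ^+ 2 <= 1.
  by rewrite -ler_pdivlMr ?exprn_gt0 // div1r ge_min lexx orbT.
have := Hb b b0 bK; rewrite -!mulmxA => H1.
move: Hv; rewrite mulmxN -scalemxAr => Hv.
have Hv2 : norm2 (c + A *m v) ^+ 2 <= norm2 (c - beta *: (A *m (A^T *m c))) ^+ 2.
  by rewrite lerXn2r // nnegrE norm2_ge0.
have : norm2 (c - b *: (A *m (A^T *m c))) ^+ 2 <=
    norm2 c ^+ 2 - b * norm2 (A^T *m c) ^+ 2.
  have -> : norm2 (c - b *: (A *m (A^T *m c))) ^+ 2 = norm2 c ^+ 2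
     - 2 * b * norm2 (A^T *m c) ^+ 2 + b ^+ 2 * norm2 (A *m (A^T *m c)) ^+ 2.
    rewrite !norm2_sqr !vdotE (vdotC c) vdotMl; ring.
  have : norm2 (A *m (A^T *m c)) ^+ 2 <= B ^+ 2 * norm2 (A^T *m c) ^+ 2.
    by rewrite -exprMn lerXn2r ?nnegrE ?mulr_ge0 ?norm2_ge0 // ltW.
  move=> /(ler_wpM2l (sqr_ge0 b)) H2.
  have := ler_wpM2r (mulr_ge0 b0 (sqr_ge0 (norm2 (A^T *m c)))) bB.
  by lra.
by lra.
Qed.

(** The choice of [k] ensures [k a <= min(kv a, 1 / B^2)] whenever [a <= a0], so the constants do
    not depend on [a]. Factoring [|c|^2 - |c + A v|^2] turns the decrease of squares into one of
    norms. *)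
Lemma normal_step_decrease (R : realType) m n (A : 'M[R]_(m, n)) c v
    (B kv a a0 beta s : R) (k := Num.min kv (B ^- 2 / a0)) :
  0 < B -> 0 < kv -> 0 < a -> a <= a0 -> 0 < s -> sigma_min_ge A s ->
  (forall w, norm2 (A *m w) <= B * norm2 w) ->
  (A^T *m c <> 0 ->
     (forall b : R, 0 <= b -> b <= kv * a ->
       norm2 (c - beta *: (A *m A^T *m c)) ^+ 2 / 2
       <= norm2 (c - b *: (A *m A^T *m c)) ^+ 2 / 2) /\
     norm2 v <= kv * a * norm2 (A^T *m c) /\
     norm2 (c + A *m v) <= norm2 (c + A *m (- (beta *: (A^T *m c))))) ->
  (A^T *m c = 0 -> v = 0) ->
  0 < k /\
  k * s ^+ 2 / 2 * a * norm2 c <= norm2 c - norm2 (c + A *m v) /\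
  k * s / (2 * kv) * norm2 v <= norm2 c - norm2 (c + A *m v).
Proof.
move=> B0 kv0 a_gt0 aa0 s0 As AB Hc H0.
have a0_gt0 : 0 < a0 by lra.
have Bm0 : 0 < B ^- 2 by rewrite invr_gt0 exprn_gt0.
have k0 : 0 < k by rewrite lt_min kv0 divr_gt0.
split=> //.
have sc := As c.
have c0 := norm2_ge0 c.
have [z|nz] := pselect (A^T *m c = 0).
  move: sc; rewrite z norm2_0 H0 // mulmx0 addr0 norm2_0 subrr => sc.
  have -> : norm2 c = 0 by apply/eqP; rewrite eq_le c0 andbT -(pmulr_rle0 _ s0).
  by rewrite !mulr0.
have [Hb [Hv Hd]] := Hc nz.
have := cauchy_decrease B0 (mulr_gt0 kv0 a_gt0) AB Hb Hd.
set b := Num.min _ _ => dec.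
have kb : k * a <= b.
  rewrite le_min ler_pM2r // ge_min lexx /=.
  have : k <= B ^- 2 / a0 by rewrite ge_min lexx orbT.
  by rewrite ler_pdivlMr // => H; apply: le_trans H; rewrite ler_pM2l.
have qp : 0 < norm2 (A^T *m c).
  by rewrite lt_def norm2_ge0 andbT; apply/eqP => /norm2_eq0.
have cp : 0 < norm2 c.
  rewrite lt_def c0 andbT; apply/eqP => /norm2_eq0 cz.
  by apply: nz; rewrite cz mulmx0.
set d := norm2 (c + _) in dec *.
have d0 : 0 <= d by exact: norm2_ge0.
set q := norm2 (A^T *m c) in dec qp Hv sc *.
have dec2 : k * a * q ^+ 2 <= norm2 c ^+ 2 - d ^+ 2.
  have := ler_wpM2r (sqr_ge0 q) kb; lra.
have dc : d <= norm2 c.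
  have : 0 <= k * a * q ^+ 2 by rewrite !mulr_ge0 ?exprn_ge0 // ltW.
  by move=> ?; rewrite -(ler_sqr d0) ?nnegrE //; lra.
have dec3 : k * a * q ^+ 2 <= 2 * norm2 c * (norm2 c - d).
  by apply: le_trans dec2 _; nra.
(* [q >= s |c|] trades one power of [q] for [|c|], which then cancels. *)
have dec4 : k * a * s * q / 2 <= norm2 c - d.
  rewrite -(ler_pM2l cp).
  have H : 0 <= k * a * q / 2 by rewrite divr_ge0 // !mulr_ge0 // ltW.
  have := ler_wpM2l H sc; lra.
split.
  apply: le_trans dec4.
  have H : 0 <= k * a * s / 2 by rewrite divr_ge0 // !mulr_ge0 // ltW.
  have := ler_wpM2l H sc; lra.
apply: le_trans dec4.
have H : 0 <= k * s / (2 * kv) by rewrite divr_ge0 // ?mulr_ge0 // ltW.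
apply: le_trans (ler_wpM2l H Hv) _.
by rewrite le_eqVlt; apply/orP; left; apply/eqP; field; lra.
Qed.

(* The subgradient is taken at [x + v + u] and not at [x + v], since the latter
   need not lie in the set where subgradients are bounded. *)
Lemma tangential_bounds (R : realType) m n (A : 'M[R]_(m, n)) r g x v u y p w (a G P t : R) :
  0 < a -> A *m u = 0 -> v = A^T *m w -> subgrad r (x + v + u) p ->
  g + a^-1 *: u + p - A^T *m y = 0 -> norm2 g <= G -> norm2 p <= P -> t <= 1 ->
  [/\ norm2 (v + u) ^+ 2 = norm2 v ^+ 2 + norm2 u ^+ 2,
      norm2 u <= a * (G + P) &
      vdot g (v + u) + t * norm2 (v + u) ^+ 2 / a + r (x + (v + u)) - r x
        <= (G + P) * norm2 v + t * norm2 v ^+ 2 / a].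
Proof.
move=> a0 Au vE rp opt gG pP t1.
have vu : vdot v u = 0 by rewrite vE vdotC -vdotMl Au vdot0l.
have sq : norm2 (v + u) ^+ 2 = norm2 v ^+ 2 + norm2 u ^+ 2.
  rewrite !norm2_sqr !vdotE (vdotC u v) vu; ring.
have opt_u : vdot g u + a^-1 * norm2 u ^+ 2 + vdot p u = 0.
  have : vdot (g + a^-1 *: u + p - A^T *m y) u = 0 by rewrite opt vdot0l.
  by rewrite norm2_sqr !vdotE vdotMl trmxK Au vdot0r; lra.
have ai : 0 < a^-1 by rewrite invr_gt0.
have G0 := norm2_ge0 g; have P0 := norm2_ge0 p.
split=> //.
  rewrite -ler_pdivrMl //.
  have [->|u0] := eqVneq (norm2 u) 0; first by rewrite mulr0; lra.
  have up : 0 < norm2 u by rewrite lt_def u0 norm2_ge0.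
  rewrite -(ler_pM2r up).
  have := cauchy_schwarzN g u; have := cauchy_schwarzN p u.
  have := ler_wpM2r (ltW up) gG; have := ler_wpM2r (ltW up) pP; lra.
have := rp x.
have -> : x - (x + v + u) = - (v + u) by rewrite -addrA opprD addrA addrN add0r.
rewrite addrA sq !vdotE => rx.
have := cauchy_schwarz g v; have := cauchy_schwarz p v.
(* Since [t <= 1], the term [t |u|^2 / a] is absorbed by the [- |u|^2 / a] coming from [opt_u]. *)
have Hu : 0 <= (1 - t) * (norm2 u ^+ 2 * a^-1).
  by apply: mulr_ge0; [lra|rewrite mulr_ge0 ?sqr_ge0 // ltW].
have := ler_wpM2r (norm2_ge0 v) gG; have := ler_wpM2r (norm2_ge0 v) pP.
lra.
Qed.

(** * Merit parameter update and monotone sequences *)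

(** As [b] bounds the trial value [d / D] from below, an update never goes below
    [min(t, (1 - e) b)]; the last bound is what the model decrease needs. *)
Lemma tau_update_spec (R : realType) (e t D d b : R) :
  0 < e < 1 -> 0 < t -> 0 < b -> (0 < D -> b <= d / D) ->
  [/\ tau_update e t D d <= t, Num.min t ((1 - e) * b) <= tau_update e t D d &
      0 < D -> tau_update e t D d * D <= d].
Proof.
move=> e01 t0 b0 Hb; rewrite /tau_update; case: (lerP D 0) => D0.
  by split=> //; rewrite ge_min lexx.
case: (lerP t (d / D)) => td.
  by split=> //; [rewrite ge_min lexx|rewrite -ler_pdivlMr].
have bd := Hb D0.
split=> [||_].
- by rewrite ge_min; apply/orP; left; nra.
- rewrite ge_min !le_min; apply/orP; right; apply/andP; split; nra.
- by rewrite -ler_pdivlMr // ge_min lexx orbT.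
Qed.

(** Once the sequence is within [e] of its infimum, every later drop is less than [e]. *)
Lemma nonincreasing_diff_small (R : realType) (P : nat -> R) :
  (forall k, 0 <= P k) -> (forall k, P k.+1 <= P k) ->
  forall e, 0 < e -> exists K, forall k, (K <= k)%N -> P k - P k.+1 < e.
Proof.
move=> P0 Pd e e0.
pose S : set R := range P.
have hi : has_inf S by split; [exists (P 0%N), 0%N|exists 0 => _ [k _ <-]].
have [_ [K _ <-] HK] := inf_adherent e0 hi.
exists K => k Kk.
have mono : P k <= P K.
  elim: k Kk => [|k IH]; first by rewrite leqn0 => /eqP ->.
  rewrite leq_eqVlt => /orP[/eqP -> //|/IH]; exact: le_trans.
have : inf S <= P k.+1 by apply: ge_inf; [exact: hi.2|exists k.+1].
by lra.
Qed.

Lemma nonincreasing_le0 (R : realType) (P : nat -> R) :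
  (forall k, P k.+1 <= P k) -> forall k, P k <= P 0%N.
Proof. by move=> Pd; elim=> // k; exact: le_trans. Qed.

(** * Limits of approximate KKT points *)

(** The subgradients live at the shifted points [z + s]. A fixed subgradient [ps] at [xs] bounds
    [r (z + s)] from below, in place of continuity of [r]; [Y] and [P] keep all errors proportional
    to [e]. *)
Lemma approx_kkt_limit (R : realType) n m g (c : 'cV[R]_n -> 'cV[R]_m) J r
    (xs : 'cV[R]_n) (Y P : R) :
  convex_fun r -> vcontinuous g -> mcontinuous J -> vcontinuous c ->
  (forall e : R, 0 < e -> exists (z : 'cV[R]_n) (y : 'cV[R]_m) (p q s : 'cV[R]_n),
     [/\ norm2 (z - xs) < e, norm2 (c z) < e, norm2 q < e & norm2 s < e] /\
     [/\ norm2 y <= Y, norm2 p <= P, subgrad r (z + s) p &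
         g z + q + p - (J z)^T *m y = 0]) ->
  kkt_point g c J r xs.
Proof.
move=> cr gc Jc cc H; split.
  apply: norm2_eq0; apply/eqP; rewrite eq_le norm2_ge0 andbT.
  apply/ler_addgt0Pr => e e0.
  have e20 : 0 < e / 2 by lra.
  have [d [d0 Hd]] := cc xs _ e20.
  have md : 0 < Num.min (e / 2) d by rewrite lt_min e20.
  have [z [y [p [q [s [[]]]]]]] := H _ md.
  rewrite !lt_min => /andP[_ /Hd H1] /andP[H2 _] _ _ _.
  have := norm2_sub_le (c xs) (c z); rewrite norm2_subC; lra.
suff [y [p [rp E]]] : exists y p, subgrad r xs p /\ g xs + p - (J xs)^T *m y = 0.
  by exists y, p.
apply: subgrad_multiplier => // w Jw.
have [ps rps] := subgrad_exists xs cr.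
have W0 := norm2_ge0 w; have ps0 := norm2_ge0 ps.
rewrite -subr_ge0.
have [P0 Y0] : 0 <= P /\ 0 <= Y.
  have [z [y [p [q [s [_ [yY pP _ _]]]]]]] := H 1 ltr01.
  by split; [apply: le_trans pP|apply: le_trans yY]; exact: norm2_ge0.
(* [C] collects the coefficients of [e] in the final estimate; the [+ 1] keeps it positive. *)
pose C := 2 * norm2 ps + 2 * P + 2 * norm2 w + Y * norm2 w + 1.
have C0 : 0 < C by have := mulr_ge0 Y0 W0; rewrite /C; lra.
apply/ler_addgt0Pr => e1 e10; pose e := e1 / C.
have e0 : 0 < e by rewrite divr_gt0.
have -> : e1 = C * e by rewrite /e mulrCA divff ?mulr1 ?gt_eqF.
have [d1 [d10 Hd1]] := gc xs _ e0.
have [d2 [d20 Hd2]] := Jc xs _ e0.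
have md : 0 < Num.min e (Num.min d1 d2) by rewrite !lt_min e0 d10.
have [z [y [p [q [s [[]]]]]]] := H _ md.
rewrite !lt_min => /andP[ze /andP[/Hd1 gz /Hd2 Jz]] _ /andP[qe _] /andP[se _].
move=> [yY pP rp E].
have r1 := rp (xs + w).
have r2 := rps (z + s).
have pw : vdot p w = vdot y ((J z - J xs) *m w) - vdot (g z - g xs) w
                     - vdot (g xs) w - vdot q w.
  have : vdot (g z + q + p - (J z)^T *m y) w = 0 by rewrite E vdot0l.
  by rewrite mulmxBl Jw subr0 !vdotE vdotMl trmxK; lra.
have t1 := cauchy_schwarzN y ((J z - J xs) *m w).
have t2 := cauchy_schwarz (g z - g xs) w.
have t3 := cauchy_schwarz q w.
have t4 := cauchy_schwarzN p (xs - z - s).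
have t5 := cauchy_schwarzN ps (z + s - xs).
have E4 : xs + w - (z + s) = xs - z - s + w by apply/colP => i; rewrite !mxE; ring.
rewrite E4 vdotDr in r1.
have n4 : norm2 (xs - z - s) <= 2 * e.
  by have := norm2B (xs - z) s; rewrite (norm2_subC xs); lra.
have n5 : norm2 (z + s - xs) <= 2 * e.
  by have := norm2D (z - xs) s; rewrite addrAC; lra.
have m1 : norm2 y * norm2 ((J z - J xs) *m w) <= Y * (e * norm2 w).
  by apply: ler_pM => //; exact: norm2_ge0.
have m2 : norm2 (g z - g xs) * norm2 w <= e * norm2 w by rewrite ler_wpM2r // ltW.
have m3 : norm2 q * norm2 w <= e * norm2 w by rewrite ler_wpM2r // ltW.
have m4 : norm2 p * norm2 (xs - z - s) <= P * (2 * e).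
  by apply: ler_pM => //; exact: norm2_ge0.
have m5 : norm2 ps * norm2 (z + s - xs) <= norm2 ps * (2 * e) by rewrite ler_wpM2l.
rewrite /C; lra.
Qed.

Lemma jacobian_continuous (R : realType) n m (c : 'cV[R]_n -> 'cV[R]_m) J :
  has_jacobian c J -> vcontinuous c.
Proof.
move=> cJ z e e0.
have [B [B0 HB]] : exists B, 0 <= B /\ forall w, norm2 (J z *m w) <= B * norm2 w.
  (* The sum of the column norms bounds the operator norm of [J z]. *)
  pose F := \sum_i norm2 (col i (J z)); exists F; split.
    by apply: sumr_ge0 => i _; exact: norm2_ge0.
  move=> w.
  have wi i : `|w i ord0| <= norm2 w.
    rewrite -sqrtr_sqr ler_wsqrtr // /vdot (bigD1 i) //= expr2 lerDl.
    by apply: sumr_ge0 => j _; rewrite -expr2 sqr_ge0.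
  have -> : J z *m w = \sum_i w i ord0 *: col i (J z).
    apply/colP => k; rewrite mxE summxE; apply: eq_bigr => i _.
    by rewrite !mxE mulrC.
  rewrite mulr_suml.
  elim/big_ind2: _ => [|a b a' b' H1 H2|i _]; first by rewrite norm2_0.
    by apply: le_trans (norm2D _ _) _; exact: lerD.
  by rewrite norm2Z mulrC ler_wpM2l ?norm2_ge0.
have [d [d0 Hd]] := cJ z 1 ltr01.
have dp : 0 < Num.min d (e / (B + 2)) by rewrite lt_min d0 divr_gt0 //; lra.
exists (Num.min d (e / (B + 2))); split => // y.
rewrite lt_min ltr_pdivlMr; last by lra.
move=> /andP[/Hd H1 H2].
have := norm2D (c y - c z - J z *m (y - z)) (J z *m (y - z)); rewrite subrK.
have := HB (y - z); have := norm2_ge0 (y - z); lra.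
Qed.

(** * Model decrease and acceptance at small step sizes *)

(** [D] exceeds the model with weight [1/2] by [su q / a], whence the first term;
    [t D <= (1 - sc) d], automatic when [D <= 0], leaves [sc d]. *)
Lemma model_decrease_ge (R : realType) (t b q d su sc a : R)
    (D := b + (su + 1 / 2) * q / a) :
  (0 < D -> t * D <= (1 - sc) * d) -> 0 < a -> 0 <= d -> sc <= 1 -> 0 <= t ->
  t * su * q / a + sc * d <= - t * (b + 1 / (2 * a) * q) + d.
Proof.
move=> HD a0 d0 sc1 t0.
have -> : - t * (b + 1 / (2 * a) * q) + d = - (t * D) + d + t * su * q / a.
  by rewrite /D; field; lra.
have [D0|D0] := ltP 0 D; first by have := HD D0; lra.
have : 0 <= t * - D by apply: mulr_ge0 => //; lra.
have : 0 <= (1 - sc) * d by apply: mulr_ge0 => //; lra.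
lra.
Qed.

(** The claim amounts to [2 a M <= t (1 - 2 a L)]. The bound on [a] gives this at [t = tm] and also
    [1 - 2 a L >= 0], so it persists for larger [t]. *)
Lemma small_step_size (R : realType) (t tm L M a : R) :
  0 < tm -> tm <= t -> 0 < L -> 0 < M -> 0 < a -> a <= tm / (2 * (tm * L + M)) ->
  t * L + M <= t * (1 / (2 * a)).
Proof.
move=> tm0 tmt L0 M0 a0.
have p0 : 0 < 2 * (tm * L + M) by rewrite mulr_gt0 // addr_gt0 // mulr_gt0.
rewrite ler_pdivlMr // => H.
have H1 : 0 <= 1 - 2 * a * L.
  rewrite -(pmulr_rge0 _ tm0); have := mulr_gt0 a0 M0; nra.
have -> : t * (1 / (2 * a)) = t / (2 * a) by field; lra.
rewrite ler_pdivlMr; last by lra.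
have : 0 <= (t - tm) * (1 - 2 * a * L) by apply: mulr_ge0 => //; lra.
lra.
Qed.

(* The prox term [|s|^2 / (2 a)] in the model absorbs the curvature [t L + M]. *)
Lemma sufficient_decrease (R : realType) n m (f r : 'cV[R]_n -> R) g
    (c : 'cV[R]_n -> 'cV[R]_m) (A : 'M[R]_(m, n)) z s (t L M a eta : R)
    (dq := - t * (vdot g s + 1 / (2 * a) * norm2 s ^+ 2 + r (z + s) - r z)
           + norm2 (c z) - norm2 (c z + A *m s)) :
  f (z + s) - f z - vdot g s <= L * norm2 s ^+ 2 ->
  norm2 (c (z + s) - c z - A *m s) <= M * norm2 s ^+ 2 ->
  0 <= t -> t * L + M <= t * (1 / (2 * a)) -> 0 <= dq -> eta <= 1 ->
  merit f r c t (z + s) <= merit f r c t z - eta * dq.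
Proof.
move=> Hf Hc t0 H dq0 e1; rewrite /merit.
have := norm2_sub_le (c (z + s)) (c z + A *m s); rewrite opprD addrA => Hn.
have Hf' := ler_wpM2l t0 Hf.
have H' := ler_wpM2r (sqr_ge0 (norm2 s)) H.
have : 0 <= (1 - eta) * dq by apply: mulr_ge0 => //; lra.
move: (1 / (2 * a)) => b in H' dq dq0 *.
rewrite /dq; lra.
Qed.

(** The bounds in [standing_assumption] carry no sign; upward closure lets them be taken
    positive. *)
Lemma positive_bound (R : realType) (P : R -> Prop) :
  (forall a b, P a -> a <= b -> P b) -> (exists a, P a) -> exists a, 0 < a /\ P a.
Proof.
move=> mono [a Pa]; exists (Num.max 1 a); split; first by rewrite lt_max ltr01.
by apply: mono Pa _; rewrite le_max lexx orbT.
Qed.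

(** * Convergence of the algorithm *)

Theorem theorem3p18 (R : realType) (n m : nat)
    (f : 'cV[R]_n -> R) (g : 'cV[R]_n -> 'cV[R]_n)
    (c : 'cV[R]_n -> 'cV[R]_m) (J : 'cV[R]_n -> 'M[R]_(m, n))
    (r : 'cV[R]_n -> R)
    (kappa_v sigma_c eps_tau xi eta sigma_u tau_m1 : R)
    (x : nat -> 'cV[R]_n) (alpha tau betac : nat -> R)
    (v u : nat -> 'cV[R]_n) (smin : R) (xs : 'cV[R]_n) :
  (m <= n)%N ->
  C1_scalar f g -> C1_vector c J ->
  (forall z, 0 <= r z) -> convex_fun r ->
  0 < kappa_v ->
  0 < sigma_c < 1 -> 0 < eps_tau < 1 -> 0 < xi < 1 -> 0 < eta < 1 ->
  0 < sigma_u <= 1 / 2 ->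
  0 < alpha 0%N -> 0 < tau_m1 ->
  algo_run f g c J r kappa_v sigma_c eps_tau xi eta sigma_u tau_m1 x alpha tau betac v u ->
  never_terminates c J x v u ->
  standing_assumption f g c J r x v u ->
  0 < smin -> (forall k, sigma_min_ge (J (x k)) smin) ->
  limit_point x xs ->
  kkt_point g c J r xs.
Proof.
move=> _ [fg gc] [cJ Jc] r0 cr kv0 /andP[sc0 sc1] /andP[et0 et1] /andP[xi0 xi1].
move=> /andP[eta0 eta1] /andP[su0 su1] a00 tm10 run _ SA s0 Js lim.
case: SA => X [_ [cX [Xx [Xs [[lb flb] [bg [bLg [bc [bJ [bLJ br]]]]]]]]]].
have [G [G0 gG]] : exists G, 0 < G /\ forall z, X z -> norm2 (g z) <= G.
  by apply: positive_bound bg => a b H ab z /H; lra.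
have [C [C0 cC]] : exists C, 0 < C /\ forall z, X z -> norm2 (c z) <= C.
  by apply: positive_bound bc => a b H ab z /H; lra.
have [B [B0 JB]] : exists B, 0 < B /\
    forall z w, X z -> norm2 (J z *m w) <= B * norm2 w.
  apply: positive_bound bJ => a b H ab z w /H - /(_ w) /le_trans; apply.
  by rewrite ler_wpM2r ?norm2_ge0.
have [P [P0 rP]] : exists P, 0 < P /\ forall z w, X z -> subgrad r z w -> norm2 w <= P.
  by apply: positive_bound br => a b H ab z w Xz /(H _ _ Xz); lra.
have [L [L0 gL]] : exists L, 0 < L /\ forall z w, X z -> X w ->
    norm2 (g z - g w) <= L * norm2 (z - w).
  apply: positive_bound bLg => a b H ab z w Xz /(H _ _ Xz) /le_trans; apply.
  by rewrite ler_wpM2r ?norm2_ge0.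
have [M [M0 JM]] : exists L, 0 < L /\ forall z z' w, X z -> X z' ->
    norm2 ((J z - J z') *m w) <= L * norm2 (z - z') * norm2 w.
  apply: positive_bound bLJ => a b H ab z z' w Xz /(H _ _ w Xz) /le_trans; apply.
  by rewrite !ler_wpM2r ?norm2_ge0.
pose s k := v k + u k.
pose dq k := - tau k * (vdot (g (x k)) (s k) + 1 / (2 * alpha k) * norm2 (s k) ^+ 2
  + r (x k + s k) - r (x k)) + norm2 (c (x k)) - norm2 (c (x k) + J (x k) *m s k).
pose acc k := merit f r c (tau k) (x k + s k) <= merit f r c (tau k) (x k) - eta * dq k.
have step k : if acc k then x k.+1 = x k + s k /\ alpha k.+1 = alpha k
    else x k.+1 = x k /\ alpha k.+1 = xi * alpha k.
  by have [_ [_ [_ [_]]]] := run k.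
have a_gt0 k : 0 < alpha k.
  elim: k => // k IH; have := step k.
  by case: (acc k) => -[_ ->] //; rewrite mulr_gt0.
have a_dec k : alpha k.+1 <= alpha k.
  have := step k; case: (acc k) => -[_ ->] //.
  by rewrite ger_pMl //; exact: ltW.
have a_le k : alpha k <= alpha 0%N by exact: nonincreasing_le0.
pose d k := norm2 (c (x k)) - norm2 (c (x k) + J (x k) *m v k).
(* [alpha] never increases, so its initial value makes one [kp] serve all iterations. *)
pose kp := Num.min kappa_v (B ^- 2 / alpha 0%N).
have normal k : 0 < kp /\ kp * smin ^+ 2 / 2 * alpha k * norm2 (c (x k)) <= d k /\
    kp * smin / (2 * kappa_v) * norm2 (v k) <= d k.
  have [H1 [H2 _]] := run k.
  apply: (normal_step_decrease B0 kv0 (a_gt0 k) (a_le k) s0 (Js k)) H2 => [w|/H1].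
    exact: JB.
  by move=> [[_ [_ Hb]] [_ Hv]]; split; [exact: Hb|].
have kp0 : 0 < kp by have [] := normal 0%N.
have k1_gt0 : 0 < kp * smin / (2 * kappa_v) by rewrite divr_gt0 // mulr_gt0.
have d0 k : 0 <= d k.
  have [_ [_ H]] := normal k; apply: le_trans H.
  by rewrite mulr_ge0 ?norm2_ge0 //; exact: ltW.
have vrange k : exists w, v k = (J (x k))^T *m w.
  have [H1 [H2 _]] := run k.
  have [/H2 ->|/H1 [_ []//]] := pselect ((J (x k))^T *m c (x k) = 0).
  by exists 0; rewrite mulmx0.
have v_le k : norm2 (v k) <= kappa_v * alpha k * (B * C).
  have [H1 [H2 _]] := run k.
  have [/H2 ->|/H1 [_ [_ [H _]]]] := pselect ((J (x k))^T *m c (x k) = 0).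
    by rewrite norm2_0 !mulr_ge0 //; exact: ltW.
  apply: le_trans H _; apply: ler_wpM2l; first by rewrite mulr_ge0 //; exact: ltW.
  apply: le_trans (norm2_trmx (ltW B0) (fun w => JB _ w (Xx k)) _) _.
  by rewrite ler_wpM2l ?cC //; exact: ltW.
have Ju k : J (x k) *m u k = 0 by have [_ [_ [[]]]] := run k.
have Xsk k : X (x k + s k) by exact: Xs.
have opt k : exists y p, [/\ subgrad r (x k + s k) p, norm2 p <= P &
    g (x k) + (alpha k)^-1 *: u k + p - (J (x k))^T *m y = 0].
  have [_ [_ [[_ Hu] _]]] := run k.
  have [y [p [rp E]]] := prox_optimality cr (a_gt0 k) (Ju k) Hu.
  by rewrite -addrA in rp; exists y, p; split=> //; apply: rP rp; exact: Xs.
pose D k := vdot (g (x k)) (s k) + (sigma_u + 1 / 2) * norm2 (s k) ^+ 2 / alpha k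
  + r (x k + s k) - r (x k).
(* The last summand comes from [|v k|^2 / alpha k <= kappa_v B C |v k|], which removes the inverse
   step size. *)
pose E := G + P + kappa_v * (B * C).
have E0 : 0 < E by rewrite !addr_gt0 ?mulr_gt0.
have tang k : [/\ norm2 (s k) ^+ 2 = norm2 (v k) ^+ 2 + norm2 (u k) ^+ 2,
    norm2 (u k) <= alpha k * (G + P) & D k <= E * norm2 (v k)].
  have [y [p [rp pP Ek]]] := opt k; have [w vw] := vrange k.
  rewrite /s addrA in rp.
  have t1 : sigma_u + 1 / 2 <= 1 by lra.
  have [H1 H2 H3] := tangential_bounds (a_gt0 k) (Ju k) vw rp Ek (gG _ (Xx k)) pP t1.
  split=> //; apply: le_trans H3 _; rewrite /E [leRHS]mulrDl lerD2l.
  rewrite ler_pdivrMr // expr2.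
  have vk := norm2_ge0 (v k).
  have := ler_wpM2l vk (v_le k).
  have : 0 <= (1 - (sigma_u + 1 / 2)) * (norm2 (v k) * norm2 (v k)).
    by apply: mulr_ge0; [lra|exact: mulr_ge0].
  by lra.
(* A lower bound for finite trial values: [d k] is at least, and [D k] at most, a multiple of
   [|v k|], which cancels. *)
pose b := (1 - sigma_c) * (kp * smin / (2 * kappa_v)) / E.
have b0 : 0 < b by rewrite divr_gt0 // mulr_gt0 //; lra.
have Hb k : 0 < D k -> b <= (1 - sigma_c) * d k / D k.
  move=> Dk; rewrite ler_pdivlMr //.
  have [_ _ H] := tang k; have [_ [_ H2]] := normal k.
  apply: le_trans (ler_wpM2l (ltW b0) H) _.
  rewrite /b mulrA divfK ?gt_eqF // -[leLHS]mulrA ler_wpM2l //; lra.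
pose tprev k := if k is k'.+1 then tau k' else tau_m1.
pose tm := Num.min tau_m1 ((1 - eps_tau) * b).
have tm0 : 0 < tm by rewrite lt_min tm10 mulr_gt0 //; lra.
have tauE k : tau k = tau_update eps_tau (tprev k) (D k) ((1 - sigma_c) * d k).
  by have [_ [_ [_ []]]] := run k.
have e01 : 0 < eps_tau < 1 by rewrite et0.
have tau_ge k : tm <= tau k.
  have Hs j : tm <= tprev j -> tm <= tau j.
    move=> H; have t0 : 0 < tprev j by exact: lt_le_trans H.
    have [_ H1 _] := tau_update_spec e01 t0 b0 (Hb j).
    rewrite tauE; apply: le_trans H1; rewrite le_min H /tm ge_min lexx orbT //.
  elim: k => [|k IH]; apply: Hs => //=; by rewrite ge_min lexx.
have tprev0 k : 0 < tprev k.
  by case: k => [|k] //=; exact: lt_le_trans (tau_ge k).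
have tau_dec k : tau k.+1 <= tau k.
  by have [H _ _] := tau_update_spec e01 (tprev0 k.+1) b0 (Hb k.+1); rewrite tauE.
have tau0 k : 0 < tau k by exact: lt_le_trans (tau_ge k).
have dq_ge k : tau k * sigma_u * norm2 (s k) ^+ 2 / alpha k + sigma_c * d k <= dq k.
  have tD : 0 < D k -> tau k * D k <= (1 - sigma_c) * d k.
    by have [_ _ H] := tau_update_spec e01 (tprev0 k) b0 (Hb k); rewrite tauE.
  pose bs := vdot (g (x k)) (s k) + r (x k + s k) - r (x k).
  have -> : dq k = - tau k * (bs + 1 / (2 * alpha k) * norm2 (s k) ^+ 2) + d k.
    by rewrite /dq /bs /d {3}/s mulmxDr Ju addr0; ring.
  apply: model_decrease_ge => //; [|exact: ltW|exact: ltW].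
  suff -> : bs + (sigma_u + 1 / 2) * norm2 (s k) ^+ 2 / alpha k = D k by [].
  by rewrite /bs /D; ring.
have q0 k : 0 <= tau k * sigma_u * norm2 (s k) ^+ 2 / alpha k.
  by rewrite !mulr_ge0 ?invr_ge0 ?norm2_ge0 //; exact: ltW.
have scd0 k : 0 <= sigma_c * d k by rewrite mulr_ge0 //; exact: ltW.
have dq0 k : 0 <= dq k by have := dq_ge k; have := q0 k; have := scd0 k; lra.
pose abar := tm / (2 * (tm * L + M)).
have abar0 : 0 < abar by rewrite divr_gt0 // mulr_gt0 // addr_gt0 // mulr_gt0.
have small_acc k : alpha k <= abar -> acc k.
  move=> ak; apply: sufficient_decrease.
  - exact: descent_scalar fg cX (Xx k) (Xsk k) (ltW L0) gL.
  - exact: descent_vector cJ cX (Xx k) (Xsk k) (ltW M0) JM.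
  - exact: ltW.
  - exact: small_step_size ak.
  - exact: dq0.
  - exact: ltW.
(* A rejection happens only above [abar] and multiplies the step size by [xi]. *)
pose amin := Num.min (alpha 0%N) (xi * abar).
have amin0 : 0 < amin by rewrite lt_min a00 mulr_gt0.
have a_ge k : amin <= alpha k.
  elim: k => [|k IH]; first by rewrite ge_min lexx.
  have := step k; have := @small_acc k; case: (acc k) => H [_ ->] //.
  rewrite ge_min; apply/orP; right; rewrite ler_pM2l //.
  by rewrite leNgt; apply/negP => /ltW /H.
(* The shift by [lb] makes the factor of [tau k] nonnegative, so lowering [tau] cannot raise [V];
   the summand [alpha k] makes rejections lower it too. *)
pose V k := tau k * (f (x k) - lb + r (x k)) + norm2 (c (x k)) + alpha k.
have F0 k : 0 <= f (x k) - lb + r (x k).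
  by have := flb _ (Xx k); have := r0 (x k); lra.
have V0 k : 0 <= V k.
  by rewrite !addr_ge0 ?norm2_ge0 // ?mulr_ge0 //; exact: ltW.
have Vdec k : (if acc k then eta * dq k else (1 - xi) * amin) <= V k - V k.+1.
  have T : 0 <= (tau k - tau k.+1) * (f (x k.+1) - lb + r (x k.+1)).
    by rewrite mulr_ge0 // subr_ge0.
  move: T; have := step k; rewrite /V.
  case: ifP => [Hacc [-> ->] T|_ [-> ->] T].
    by move: Hacc; rewrite /acc /merit; lra.
  have : 0 <= (1 - xi) * (alpha k - amin).
    by rewrite mulr_ge0 // subr_ge0 //; exact: ltW.
  by lra.
have Vmono k : V k.+1 <= V k.
  rewrite -subr_ge0; apply: le_trans (Vdec k); case: ifP => _.
    by rewrite mulr_ge0 //; exact: ltW.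
  by rewrite mulr_ge0 ?subr_ge0 //; exact: ltW.
have dq_small e : 0 < e -> exists K, forall k, (K <= k)%N -> dq k < e.
  move=> e0.
  (* The second entry excludes rejections; the first then bounds [dq k] by [e]. *)
  have me : 0 < Num.min (eta * e) ((1 - xi) * amin).
    by rewrite lt_min !mulr_gt0 // subr_gt0.
  have [K HK] := nonincreasing_diff_small V0 Vmono me.
  exists K => k /HK; rewrite lt_min => /andP[H1 H2].
  have := Vdec k; case: ifP => _ H; last by lra.
  by rewrite -(ltr_pM2l eta0); exact: le_lt_trans H1.
(* Stationarity gives [|J^T y| <= |g| + |u / alpha| + |p| <= 2 (G + P)], and [smin] transfers this
   to [y]. *)
pose Y := 2 * (G + P) / smin.
have GP0 : 0 < G + P by rewrite addr_gt0.
apply: (@approx_kkt_limit _ _ _ _ _ _ _ _ Y P) => //.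
  exact: jacobian_continuous cJ.
move=> e e0.
pose k2 := kp * smin ^+ 2 / 2 * amin.
have k20 : 0 < k2 by rewrite !mulr_gt0 // ?invr_gt0 // exprn_gt0.
(* The entry [amin * e] controls [|u k| / alpha k], which is at most [|s k| / amin]. *)
pose de := Num.min e (amin * e).
have de0 : 0 < de by rewrite lt_min e0 mulr_gt0.
(* Through the two terms of [dq_ge], the entries force [|c (x k)| < e] and [|s k| < de]. *)
pose e1 := Num.min (sigma_c * k2 * e) (tm * sigma_u * de ^+ 2 / alpha 0%N).
have e10 : 0 < e1.
  by rewrite lt_min !mulr_gt0 ?invr_gt0.
have [K HK] := dq_small _ e10.
have [k [Kk xk]] := lim e e0 K.
have := HK k Kk; rewrite lt_min => /andP[dq1 dq2].
have [y [p [rp pP opE]]] := opt k.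
have [sq u_le _] := tang k.
have sde : norm2 (s k) < de.
  rewrite -ltr_sqr ?nnegrE ?norm2_ge0 //; last exact: ltW.
  have H1 : tau k * sigma_u * norm2 (s k) ^+ 2 / alpha k < tm * sigma_u * de ^+ 2 / alpha 0%N.
    by have := dq_ge k; have := scd0 k; lra.
  have H2 : tm * sigma_u * norm2 (s k) ^+ 2 / alpha 0%N
      <= tau k * sigma_u * norm2 (s k) ^+ 2 / alpha k.
    apply: ler_pM; rewrite ?invr_ge0 ?lef_pV2 ?posrE //.
    - by rewrite !mulr_ge0 ?norm2_ge0 //; exact: ltW.
    - exact: ltW.
    - by rewrite !ler_wpM2r ?sqr_ge0 //; exact: ltW.
  have := le_lt_trans H2 H1; rewrite ltr_pM2r ?invr_gt0 //.
  by rewrite ltr_pM2l // mulr_gt0.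
have us : norm2 (u k) <= norm2 (s k).
  by rewrite -ler_sqr ?nnegrE ?norm2_ge0 // sq lerDr sqr_ge0.
have nq : norm2 ((alpha k)^-1 *: u k) = (alpha k)^-1 * norm2 (u k).
  by rewrite norm2Z gtr0_norm // invr_gt0.
move: sde; rewrite lt_min => /andP[se sae].
exists (x k), y, p, ((alpha k)^-1 *: u k), (s k); split; split=> //.
- have [_ [H _]] := normal k.
  have H1 : k2 * norm2 (c (x k)) <= d k.
    apply: le_trans H; rewrite ler_wpM2r ?norm2_ge0 // /k2 ler_wpM2l //.
    by rewrite !mulr_ge0 ?norm2_ge0 ?invr_ge0 //; exact: ltW.
  rewrite -(ltr_pM2l k20) -(ltr_pM2l sc0).
  have := ler_wpM2l (ltW sc0) H1; have := dq_ge k; have := q0 k; lra.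
- rewrite nq mulrC ltr_pdivrMr //; apply: le_lt_trans us _; apply: lt_le_trans sae _.
  by rewrite mulrC ler_pM2l.
- rewrite /Y ler_pdivlMr // mulrC; apply: le_trans (Js k y) _.
  have -> : (J (x k))^T *m y = g (x k) + (alpha k)^-1 *: u k + p.
    by apply/esym/eqP; rewrite -subr_eq0 opE.
  have := norm2D (g (x k) + (alpha k)^-1 *: u k) p.
  have := norm2D (g (x k)) ((alpha k)^-1 *: u k).
  have : norm2 ((alpha k)^-1 *: u k) <= G + P by rewrite nq ler_pdivrMl.
  by have := gG _ (Xx k); lra.
Qed.
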